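(* For every integer $n \ge 1$, \[f(n,1) + f(n-1,2) + \cdots = \sum_{d=1}^{n} f(n+1-d,d) = a(n+1).\]
   Context: A partition of a positive integer $n$ is a finite sequence of positive integers $\lambda = (\lambda_1,\ldots,\lambda_j)$ with $\lambda_1 \ge \cdots \ge \lambda_j$ and $\sum_i \lambda_i = n$; the $\lambda_i$ are its parts. For integers $n \ge 1$ and $d \ge 1$, a partition $\lambda$ of $n$ has fixed point $d$ if $\lambda$ has at least $d$ parts and $\lambda_d = d$. Let $f(n,d)$ denote the number of partitions of $n$ with fixed point $d$. The size of the Durfee square of a partition $\lambda$ is the greatest index $i$ for which $\lambda_i \ge i$. Let $a(n)$ be the number of partitions $\lambda$ of $n$ such that the size of the Durfee square of $\lambda$ is not a part of $\lambda$. *)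

(* Defs.v *)
From HB Require Import structures.
From mathcomp Require Import all_boot.

Set Implicit Arguments.
Unset Strict Implicit.
Unset Printing Implicit Defensive.

Definition is_partition (n : nat) (s : seq nat) : bool :=
  [&& sorted geq s, 0 \notin s & sumn s == n].

Record intpart (n : nat) := IntPart {
  parts :> seq nat;
  _ : is_partition n parts
}.

HB.instance Definition _ (n : nat) := [isSub for @parts n].
HB.instance Definition _ (n : nat) := [Countable of intpart n by <:].

(* Finiteness of [intpart n]: a partition of n has at most n parts, each at
   most n, so it embeds in the finite type of such bounded sequences. *)
Lemma intpart_size (n : nat) (p : intpart n) : size p <= n.
Proof.
case: p => s /= /and3P[_ s0 /eqP<-].
elim: s s0 => //= x s IHs; rewrite inE negb_or eq_sym -lt0n => /andP[x0 /IHs le].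
by rewrite -add1n leq_add.
Qed.

Lemma intpart_le (n : nat) (p : intpart n) (x : nat) : x \in parts p -> x <= n.
Proof.
case: p => s /= /and3P[_ _ /eqP<-].
elim: s => //= y s IHs; rewrite inE => /predU1P[->|/IHs le].
  exact: leq_addr.
exact: leq_trans le (leq_addl _ _).
Qed.

Lemma intpart_bseq_subproof (n : nat) (p : intpart n) :
  size [seq inord x : 'I_n.+1 | x <- parts p] <= n.
Proof. by rewrite size_map intpart_size. Qed.

Definition bseq_of_intpart (n : nat) (p : intpart n) : n.-bseq 'I_n.+1 :=
  Bseq (intpart_bseq_subproof p).

Definition intpart_of_bseq (n : nat) (b : n.-bseq 'I_n.+1) :
    option (intpart n) :=
  insub [seq val i | i <- b].

Lemma bseq_of_intpartK (n : nat) :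
  pcancel (@bseq_of_intpart n) (@intpart_of_bseq n).
Proof.
move=> p; rewrite /intpart_of_bseq /= -map_comp map_id_in ?valK // => x xp.
by rewrite /= inordK // ltnS (intpart_le xp).
Qed.

HB.instance Definition _ (n : nat) : isFinite (intpart n) :=
  PCanIsFinite (@bseq_of_intpartK n).

(* In the next two definitions indices start at 1, so that the d-th part of s
   is [nth 0 s d.-1]. *)
Definition has_fixed_point (s : seq nat) (d : nat) : bool :=
  (0 < d <= size s) && (nth 0 s d.-1 == d).

Definition durfee (s : seq nat) : nat :=
  \max_(1 <= i < (size s).+1 | i <= nth 0 s i.-1) i.

Definition f (n d : nat) : nat :=
  #|[set p : intpart n | has_fixed_point p d]|.

Definition a (n : nat) : nat :=
  #|[set p : intpart n | durfee p \notin parts p]|.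

(* Main.v *)
(* Adjoin a part d to a partition of n+1-d with fixed point d: the result is a
   partition of n+1 whose d-th and (d+1)-st parts both equal d, and every such
   partition arises once.  Its conjugate has d-th part > d and (d+1)-st part < d,
   i.e. Durfee square of size d and no part d.  All these conditions are
   expressed through the numbers [count (ltn i) s] of parts larger than i, which
   are the parts of the conjugate of s. *)
Require Import Defs.
From mathcomp Require Import all_boot zify.

Set Implicit Arguments.
Unset Strict Implicit.
Unset Printing Implicit Defensive.

Lemma geq_trans : transitive geq.
Proof. by move=> y x z /= yx zy; apply: leq_trans zy yx. Qed.

Lemma geq_anti : antisymmetric geq.
Proof. by move=> x y /= /andP[yx xy]; apply/eqP; rewrite eqn_leq xy. Qed.

Lemma geq_total : total geq.
Proof. by move=> x y; apply: leq_total. Qed.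

(** The entries larger than [i] form a prefix of [s]. No bound on [j] is required, since the default
    value 0 never exceeds [i]. *)
Lemma count_ltn_sorted (s : seq nat) (i j : nat) :
  sorted geq s -> (j < count (ltn i) s) = (i < nth 0 s j).
Proof.
elim: s j => [|x s IHs] j; first by rewrite nth_nil.
move=> /= xs; have ss := path_sorted xs.
have [ix|xi] := ltnP i x; first by case: j => [|j] //=; rewrite add1n ltnS IHs.
have si y : y \in s -> y <= i.
  by move=> ys; apply: leq_trans xi; apply: (allP (order_path_min geq_trans xs)).
rewrite (_ : count _ s = 0); last first.
  by apply/eqP; rewrite -leqn0 leqNgt -has_count; apply/hasP => -[y /si /=]; lia.
case: j => [|j] /=; first by lia.
have [js|sj] := ltnP j (size s); last by rewrite nth_default.
by have := si _ (mem_nth 0 js); rewrite leqNgt => /negPf->.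
Qed.

Lemma count_ltn_mono (s : seq nat) (i j : nat) :
  i <= j -> count (ltn j) s <= count (ltn i) s.
Proof. by move=> ij; apply: sub_count => x /=; apply: leq_ltn_trans. Qed.

Lemma count_ltnS (s : seq nat) (i : nat) :
  count (ltn i) s = count (ltn i.+1) s + count_mem i.+1 s.
Proof. by elim: s => //= x s ->; lia. Qed.

(** Index [i.+1] meets the Durfee condition iff [i < count (ltn i) s]. The count decreases as [i]
    grows, so this condition passes to all smaller indices. *)
Lemma durfee_geS (s : seq nat) (d : nat) :
  sorted geq s -> (d < durfee s) = (d < count (ltn d) s).
Proof.
move=> ss; apply/idP/idP => [|dc].
  apply: contraTT; rewrite -!leqNgt => cd.
  apply/bigmax_leqP_seq => -[|i] //= _; rewrite -(count_ltn_sorted i i ss) => ic.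
  rewrite ltnNge; apply/negP => di.
  by have := count_ltn_mono s di; lia.
rewrite /durfee; apply: (@leq_bigmax_seq _ _ _ (fun i => i) d.+1) => /=.
  by rewrite mem_index_iota /= ltnS (leq_trans dc) ?count_size.
by rewrite -count_ltn_sorted.
Qed.

(** Both sides say that the two counts equal [d.+1]: their difference is the multiplicity of
    [d.+1]. *)
Lemma durfee_notin (s : seq nat) (d : nat) : sorted geq s ->
  (d < count (ltn d.+1) s) && (count (ltn d) s <= d.+1) =
  (d.+1 == durfee s) && (durfee s \notin s).
Proof.
move=> ss; have cS := count_ltnS s d.
have d1 := durfee_geS d ss; have d2 := durfee_geS d.+1 ss.
have [eD|nD] := eqVneq d.+1 (durfee s); last by lia.
by rewrite -eD -has_pred1 has_count; lia.
Qed.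

(** For sorted [s], the length [head 0 s] keeps exactly the nonzero counts, so that no part is 0. *)
Definition conj_seq (s : seq nat) : seq nat :=
  mkseq (fun i => count (ltn i) s) (head 0 s).

Lemma nth_conj_seq (s : seq nat) (i : nat) :
  sorted geq s -> nth 0 (conj_seq s) i = count (ltn i) s.
Proof.
move=> ss; have [ih|hi] := ltnP i (head 0 s); first by rewrite nth_mkseq.
rewrite nth_default ?size_mkseq //; apply/esym/eqP.
by rewrite -leqn0 leqNgt count_ltn_sorted // nth0 -leqNgt.
Qed.

Lemma sum_ltn_minn (n x : nat) : \sum_(0 <= i < n) (i < x : nat) = minn n x.
Proof.
elim: n => [|n IHn]; first by rewrite big_geq // min0n.
by rewrite big_nat_recr //= IHn; lia.
Qed.

(** Double counting: a part [x] is counted once for each [i < x], and every such [i] is in range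
    because [x <= head 0 s]. *)
Lemma sumn_conj_seq (s : seq nat) : sorted geq s -> sumn (conj_seq s) = sumn s.
Proof.
move=> ss; rewrite !sumnE big_map.
under eq_bigr => i _ do rewrite -sumn_count sumnE big_map.
rewrite exchange_big /= !big_seq; apply: eq_bigr => x xs.
have := sum_ltn_minn (head 0 s) x; rewrite /index_iota subn0 => ->.
apply/minn_idPr; case: s ss xs => //= y s ys; rewrite inE => /predU1P[-> //|].
exact: (allP (order_path_min geq_trans ys)).
Qed.

Lemma conj_seq_partition (n : nat) (s : seq nat) :
  is_partition n s -> is_partition n (conj_seq s).
Proof.
case/and3P=> ss s0 sn; apply/and3P; split; last by rewrite sumn_conj_seq.
  apply: homo_sorted (iota_sorted 0 _) => i j; exact: count_ltn_mono.
apply/mapP => -[i]; rewrite mem_iota add0n /= -nth0 -count_ltn_sorted // => c0 c1.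
by rewrite -c1 in c0.
Qed.

Lemma sorted_intpart (n : nat) (p : intpart n) : sorted geq p.
Proof. by case/and3P: (valP p). Qed.

Definition conj_part (n : nat) (p : intpart n) : intpart n :=
  IntPart (conj_seq_partition (valP p)).

(** Transposition of the Young diagram: both inequalities test the same cell. *)
Lemma count_ltn_conj (n : nat) (p : intpart n) (i j : nat) :
  (j < count (ltn i) (conj_part p)) = (i < count (ltn j) p).
Proof.
by rewrite count_ltn_sorted ?sorted_intpart // nth_conj_seq ?sorted_intpart.
Qed.

Lemma conj_part_inj (n : nat) : injective (@conj_part n).
Proof.
move=> p q epq; have ec i : count (ltn i) p = count (ltn i) q.
  by rewrite -!nth_conj_seq ?sorted_intpart //; case: epq => ->.
apply: val_inj; apply: (sorted_eq geq_trans geq_anti); rewrite ?sorted_intpart //.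
(* Multiplicities agree: 0 is never a part, and that of [x.+1] is a difference of consecutive
   counts. *)
apply/allP => -[|x] _ /=.
  by case/and3P: (valP p) (valP q) => _ /count_memPn-> _ /and3P[_ /count_memPn->].
by have := ec x; rewrite count_ltnS ec [RHS]count_ltnS => /addnI->.
Qed.

Lemma add_part_subproof (n d : nat) (p : intpart n) :
  is_partition (n + d.+1) (sort geq (d.+1 :: p)).
Proof.
case/and3P: (valP p) => _ p0 /eqP pn; apply/and3P; split.
- exact: sort_sorted geq_total _.
- by rewrite mem_sort inE.
- by rewrite (perm_sumn (permEl (perm_sort _ _))) /= pn addnC.
Qed.

Definition add_part (n d : nat) (p : intpart n) : intpart (n + d.+1) :=
  IntPart (add_part_subproof d p).

Lemma add_part_inj (n d : nat) : injective (@add_part n d).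
Proof.
move=> p q [] epq; apply: val_inj.
apply: (sorted_eq geq_trans geq_anti); rewrite ?sorted_intpart //.
by rewrite -(perm_cons d.+1) -(perm_sort geq) /= epq perm_sort.
Qed.

Lemma has_fixed_pointE (s : seq nat) (d : nat) : sorted geq s ->
  has_fixed_point s d.+1 = (d < count (ltn d) s) && (count (ltn d.+1) s <= d).
Proof.
move=> ss; rewrite /has_fixed_point /= (leqNgt (count _ _)) !count_ltn_sorted //.
have [ds|sd] := ltnP d (size s); first by lia.
by rewrite nth_default //; lia.
Qed.

Lemma f_add_part (n d : nat) :
  f n d.+1 = #|[set p : intpart (n + d.+1) |
                (d.+1 < count (ltn d) p) && (count (ltn d.+1) p <= d)]|.
Proof.
rewrite /f -(card_imset _ (@add_part_inj n d)); apply: eq_card => p.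
have add_fixed (q : intpart n) : has_fixed_point q d.+1 =
    (d.+1 < count (ltn d) (add_part d q)) && (count (ltn d.+1) (add_part d q) <= d).
  (* The new part [d.+1] raises [count (ltn d)] by one and leaves [count (ltn d.+1)] unchanged. *)
  rewrite has_fixed_pointE ?sorted_intpart //= !count_sort /=.
  by rewrite ltnn ltnSn add0n add1n ltnS.
rewrite inE; apply/imsetP/idP => [[q] + ->|Bp]; first by rewrite inE add_fixed.
(* The two counts differ by at least 2, so [d.+1] occurs and can be removed. *)
have dp : d.+1 \in parts p.
  rewrite -has_pred1 has_count -(ltn_add2l (count (ltn d.+1) p)) -count_ltnS.
  by case/andP: Bp; lia.
have /perm_sumn /= sum_p := perm_to_rem dp.
have q_part : is_partition n (rem d.+1 p).
  case/and3P: (valP p) => ps p0 /eqP pn; apply/and3P; split.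
  - exact: (subseq_sorted geq_trans (rem_subseq _ _) ps).
  - by apply: contra p0; apply: mem_rem.
  - by rewrite -(eqn_add2l d.+1) -sum_p pn addnC.
have pE : p = add_part d (IntPart q_part).
  apply: val_inj; apply: (sorted_eq geq_trans geq_anti); rewrite ?sorted_intpart //.
  by rewrite /= perm_sym perm_sort perm_sym perm_to_rem.
by exists (IntPart q_part); rewrite // inE add_fixed -pE.
Qed.

Lemma f_durfee (n d : nat) :
  f n d.+1 = #|[set p : intpart (n + d.+1) |
                (d.+1 == durfee p) && (durfee p \notin parts p)]|.
Proof.
rewrite f_add_part -[RHS](card_preimset _ (@conj_part_inj _)).
apply: eq_card => p; rewrite !inE -durfee_notin ?sorted_intpart //.
(* Transposing swaps [d] and [d.+1] in each inequality; the second is first written as a negated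
   strict one. *)
by rewrite count_ltn_conj [in RHS](leqNgt _ d.+1) count_ltn_conj -leqNgt.
Qed.

Lemma durfee_notin_bounds (n : nat) (p : intpart n.+1) :
  durfee p \notin parts p -> 0 < durfee p <= n.
Proof.
move=> Dp; have sp := sorted_intpart p.
have D0 : 0 < durfee p.
  rewrite durfee_geS // -has_count.
  case: p {Dp sp} => -[//|x s] /= /and3P[_ + _].
  by rewrite inE negb_or eq_sym -lt0n => /andP[->].
rewrite D0 /=; have := durfee_notin (durfee p).-1 sp.
rewrite prednK // eqxx Dp => /andP[dc _].
(* Some part strictly exceeds the Durfee size, which sharpens the bound from [n.+1] to [n]. *)
have /hasP[x xp /= Dx] : has (ltn (durfee p)) p.
  by rewrite has_count; apply: leq_trans dc.
by rewrite -ltnS (leq_trans Dx (intpart_le xp)).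
Qed.

Theorem theorem1p2 (n : nat) (hn : 0 < n) :
  \sum_(1 <= d < n.+1) f (n + 1 - d) d = a (n + 1).
Proof.
rewrite addn1 /a -sum1dep_card.
transitivity (\sum_(1 <= d < n.+1) \sum_(p : intpart n.+1)
                ((d == durfee p) && (durfee p \notin parts p) : nat)).
  apply: eq_big_nat => -[//|d] /andP[_ dn].
  rewrite f_durfee subnK; last by lia.
  by rewrite -sum1dep_card big_mkcond; apply: eq_bigr => p _; case: ifP.
rewrite exchange_big [RHS]big_mkcond /=; apply: eq_bigr => p _.
case: ifP => [Dp|_]; last by rewrite big1 // => d _; rewrite andbF.
have D_bounds := durfee_notin_bounds Dp.
(* Each counted partition contributes only at [d = durfee p], which lies in the summation range. *)
rewrite (bigD1_seq (durfee p)) ?mem_index_iota ?iota_uniq //= eqxx.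
by rewrite big1 // => d /negPf->.
Qed.
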